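(* Let $N_1,N_2,N_w,N_b,N$ and $T$ be as in the context, and let $\lambda_k=1-\frac{k(N-k+1)}{N_1N_2}$ for $k=0,\dots,N_w$. For each $k$ define $b^k=(b^k_0,\dots,b^k_{N_w})$ by $b^k_i=0$ for $i<k$ and $$b^k_i=(-1)^{i-k}\,\frac{(k-N_1)_{i-k}\,(k-N_w)_{i-k}}{(i-k)!\,(2k-N)_{i-k}},\qquad k\le i\le N_w$$ (all denominators are nonzero). Then $b^k$ satisfies, for all $i=0,\dots,N_w$ (with $b^k_{-1}:=0$), $$N_1N_2(\lambda_k-1)\,b^k_i=(N_1-i+1)(N_w-i+1)\,b^k_{i-1}-i\,(N_w-i+N_b+1)\,b^k_i,$$ and consequently the vector $c$ with $c_i=\sum_{j=i}^{N_w}(-1)^{j-i}\binom{j}{i}b^k_j$ is a nonzero right eigenvector of $T$ with eigenvalue $\lambda_k$. Equivalently, the polynomial $H^{(k)}(u,y,z)=\sum_{i=k}^{N_w}b^k_i\,u^iy^{N_1-i}z^{N_w-i}$ yields, via $G^{(k)}(x,y,z)=H^{(k)}(x-yz,y,z)=\sum_i c_i x^iy^{N_1-i}z^{N_w-i}$, the eigenvector coefficients $c_i$.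
   Context: Integers $N_1,N_2\ge1$, $N_w,N_b\ge0$ with $N_w+N_b=N_1+N_2=:N$, $N_w\le N_1$, $N_w\le N_2$. States $i\in\{0,\dots,N_w\}$. $p_i=\frac{(N_1-i)(N_w-i)}{N_1N_2}$, $q_i=\frac{i(N_b-N_1+i)}{N_1N_2}$, $r_i=1-p_i-q_i$. $T$ is the $(N_w+1)\times(N_w+1)$ matrix with $T_{i+1,i}=p_i$, $T_{i-1,i}=q_i$, $T_{ii}=r_i$, other entries $0$ (columns sum to 1). Right eigenvector: $Tc=\lambda c$. $(a)_n=a(a+1)\cdots(a+n-1)$, $(a)_0=1$. *)

(* Defs.v *)
From HB Require Import structures.
From mathcomp Require Import all_boot all_order all_algebra.
Set Implicit Arguments. Unset Strict Implicit. Unset Printing Implicit Defensive.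
Import Order.TTheory GRing.Theory Num.Theory.
Local Open Scope ring_scope.

Definition poch {R : numFieldType} (a : R) (n : nat) : R :=
  \prod_(m < n) (a + m%:R).

Section Chain.
Variables (R : numFieldType) (N1 N2 Nw Nb : nat).

Definition pp (i : nat) : R :=
  (N1%:R - i%:R) * (Nw%:R - i%:R) / (N1%:R * N2%:R).
Definition qq (i : nat) : R :=
  i%:R * (Nb%:R - N1%:R + i%:R) / (N1%:R * N2%:R).
Definition rr (i : nat) : R := 1 - pp i - qq i.

Definition Tmx : 'M[R]_(Nw.+1) :=
  \matrix_(a < Nw.+1, s < Nw.+1)
    if (a == s.+1 :> nat) then pp s
    else if (a.+1 == s :> nat) then qq s
    else if (a == s :> nat) then rr s
    else 0.

(* N = N1 + N2 *)
Definition lam (k : nat) : R :=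
  1 - (k%:R * ((N1 + N2)%:R - k%:R + 1)) / (N1%:R * N2%:R).

Definition bden (k i : nat) : R :=
  (i - k)`!%:R * poch (2 * k%:R - (N1 + N2)%:R) (i - k).

Definition bk (k i : nat) : R :=
  if (i < k)%N then 0
  else (-1) ^+ (i - k) * poch (k%:R - N1%:R) (i - k)
         * poch (k%:R - Nw%:R) (i - k) / bden k i.

Definition bprev (k i : nat) : R := if i is i'.+1 then bk k i' else 0.

Definition cvec (k : nat) : 'cV[R]_(Nw.+1) :=
  \col_(a < Nw.+1)
    \sum_(a <= j < Nw.+1) (-1) ^+ (j - a) * 'C(j, a)%:R * bk k j.

End Chain.

(* Main.v *)
Require Import Defs.
From HB Require Import structures.
From mathcomp Require Import all_boot all_order all_algebra.
From mathcomp Require Import zify ring.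
Set Implicit Arguments. Unset Strict Implicit. Unset Printing Implicit Defensive.
Import Order.TTheory GRing.Theory Num.Theory.
Local Open Scope ring_scope.

(* Let S be the upper-triangular matrix S_{a,j} = (-1)^(j+a) C(j,a) (the
   substitution u = x - yz of the paper, read on coefficients) and M the
   lower-bidiagonal matrix with M_{j,j} = 1 - j (N_w - j + N_b + 1)/(N_1 N_2)
   and M_{j,j-1} = (N_1 - j + 1)(N_w - j + 1)/(N_1 N_2).  A direct binomial
   computation gives the intertwining relation  T S = S M.  Hence whenever
   M b = lambda b, the vector c = S b satisfies T c = lambda c.

   Since c = S b^k ends with the nonzero entry b^k_{N_w}, the
   main theorem follows. *)

Lemma sum_ord_pick (R : numFieldType) (n m : nat) (F : nat -> R) :
  \sum_(s < n) (if s == m :> nat then F s else 0) = if (m < n)%N then F m else 0.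
Proof. by rewrite -big_mkcond big_ord1_eq. Qed.

Lemma natr_binS (R : numFieldType) (n m : nat) :
  ('C(n, m.+1)%:R * m.+1%:R : R) = 'C(n, m)%:R * (n%:R - m%:R).
Proof.
have [le_mn | lt_nm] := leqP m n.
  by rewrite -natrB // -!natrM mulnC mul_bin_left mulnC.
by rewrite !bin_small ?mul0r // ltnW.
Qed.

Lemma natr_sub_neq0 (R : numFieldType) (x y : nat) :
  x != y -> (x%:R - y%:R : R) != 0.
Proof. by move=> h; rewrite subr_eq0 eqr_nat. Qed.

Lemma pochS (R : numFieldType) (a : R) (n : nat) :
  poch a n.+1 = poch a n * (a + n%:R).
Proof. by rewrite /poch big_ord_recr. Qed.

Lemma poch_neq0 (R : numFieldType) (a : R) (n : nat) :
  (forall m, (m < n)%N -> a + m%:R != 0) -> poch a n != 0.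
Proof. by move=> h; apply/prodf_neq0 => m _; apply: h. Qed.

Lemma poch_natr_neq0 (R : numFieldType) (x y n : nat) :
  (forall m, (m < n)%N -> x + m != y) -> poch (x%:R - y%:R : R) n != 0.
Proof.
move=> h; apply: poch_neq0 => m /h hm.
by rewrite addrAC -natrD natr_sub_neq0.
Qed.

Lemma natr_Nb (R : numFieldType) {N1 N2 Nw Nb : nat} :
  (Nw + Nb = N1 + N2)%N -> (Nb%:R : R) = N1%:R + N2%:R - Nw%:R.
Proof. by move=> hsum; rewrite -natrD -hsum natrD; ring. Qed.

Section Intertwining.
Variables (R : numFieldType) (N1 N2 Nw Nb : nat).

Local Notation D := (N1%:R * N2%:R : R).
Local Notation pp := (pp R N1 N2 Nw).
Local Notation qq := (qq R N1 N2 Nb).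
Local Notation rr := (rr R N1 N2 Nw Nb).
Local Notation Tmx := (Tmx R N1 N2 Nw Nb).

Definition sgbin (a j : nat) : R := (-1) ^+ (j + a) * 'C(j, a)%:R.

Definition Smx : 'M[R]_(Nw.+1) := \matrix_(a, j) sgbin a j.

Definition mdiag (j : nat) : R := 1 - j%:R * (Nw%:R - j%:R + Nb%:R + 1) / D.
Definition msub (j : nat) : R := (N1%:R - j%:R + 1) * (Nw%:R - j%:R + 1) / D.

Definition Mmx : 'M[R]_(Nw.+1) :=
  \matrix_(l, j) if l == j :> nat then mdiag j
                 else if l == j.+1 :> nat then msub l else 0.

Lemma Tmx_row (f : nat -> R) (a : 'I_Nw.+1) :
  \sum_(s < Nw.+1) Tmx a s * f s
  = (if (0 < a)%N then pp a.-1 * f a.-1 else 0)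
    + (if (a < Nw)%N then qq a.+1 * f a.+1 else 0) + rr a * f a.
Proof.
pose fp s := if (0 < a)%N then pp s * f s else 0.
pose fq s := qq s * f s; pose fr s := rr s * f s.
rewrite (eq_bigr (fun s : 'I_Nw.+1 => (if s == a.-1 :> nat then fp s else 0)
  + (if s == a.+1 :> nat then fq s else 0)
  + (if s == a :> nat then fr s else 0))); last first.
  move=> s _; rewrite mxE /fp /fq /fr.
  by do ![case: ifP]; move=> *; rewrite ?mul0r ?addr0 ?add0r //; lia.
have ha : (a.-1 <= Nw)%N by rewrite (leq_trans (leq_pred a)) // -ltnS.
by rewrite !big_split /= !sum_ord_pick ltn_ord ltnS ha.
Qed.

Lemma Mmx_col (f : nat -> R) (j : 'I_Nw.+1) :
  \sum_(l < Nw.+1) f l * Mmx l j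
  = f j * mdiag j + (if (j < Nw)%N then f j.+1 * msub j.+1 else 0).
Proof.
pose fd l := f l * mdiag j; pose fs l := f l * msub l.
rewrite (eq_bigr (fun l : 'I_Nw.+1 => (if l == j :> nat then fd l else 0)
  + (if l == j.+1 :> nat then fs l else 0))); last first.
  move=> l _; rewrite mxE /fd /fs.
  by do ![case: ifP]; move=> *; rewrite ?mulr0 ?addr0 ?add0r //; lia.
by rewrite big_split /= !sum_ord_pick ltn_ord ltnS.
Qed.

Lemma Mmx_row (f : nat -> R) (j : 'I_Nw.+1) :
  \sum_(l < Nw.+1) Mmx j l * f l
  = mdiag j * f j + (if (0 < j)%N then msub j * f j.-1 else 0).
Proof.
pose fd l := mdiag l * f l.
pose fs l := if (0 < j)%N then msub j * f l else 0.
rewrite (eq_bigr (fun l : 'I_Nw.+1 => (if l == j :> nat then fd l else 0)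
  + (if l == j.-1 :> nat then fs l else 0))); last first.
  move=> l _; rewrite mxE /fd /fs.
  by do ![case: ifP]; move=> *; rewrite ?mul0r ?addr0 ?add0r //; lia.
have hj : (j.-1 < Nw.+1)%N by rewrite (leq_ltn_trans (leq_pred j)).
by rewrite big_split /= !sum_ord_pick ltn_ord hj.
Qed.

Hypotheses (hN1 : (1 <= N1)%N) (hN2 : (1 <= N2)%N) (hsum : (Nw + Nb = N1 + N2)%N).

(* Column-wise form of T S = S M: the three-term action of T on the column
   (sgbin a j)_a is a combination of columns j and j+1. *)
Lemma sgbin_step (a j : nat) :
  (if (0 < a)%N then pp a.-1 * sgbin a.-1 j else 0)
  + qq a.+1 * sgbin a.+1 j + rr a * sgbin a j
  = sgbin a j * mdiag j + sgbin a j.+1 * msub j.+1.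
Proof.
have hA : (N1%:R != 0 :> R) by rewrite pnatr_eq0 -lt0n.
have hB : (N2%:R != 0 :> R) by rewrite pnatr_eq0 -lt0n.
rewrite /sgbin /rr /pp /qq /mdiag /msub (natr_Nb R hsum).
case: a => [|a] /=.
  rewrite bin1 !bin0 !addn0 !addn1 !exprS -!nat1r.
  set sg := (-1) ^+ j; clearbody sg; field.
  by rewrite hA hB.
have ha1 : (a.+1%:R : R) != 0 by rewrite pnatr_eq0.
have ha2 : (a.+2%:R : R) != 0 by rewrite pnatr_eq0.
have eC2 : ('C(j, a.+2)%:R : R) = 'C(j, a.+1)%:R * (j%:R - a.+1%:R) / a.+2%:R.
  by rewrite -natr_binS mulfK.
have eC1 : ('C(j, a.+1)%:R : R) = 'C(j, a)%:R * (j%:R - a%:R) / a.+1%:R.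
  by rewrite -natr_binS mulfK.
rewrite binS natrD eC2 eC1 !addnS !addSn !exprS.
set sg := (-1) ^+ (j + a); clearbody sg.
move: ha1 ha2; rewrite -!nat1r => ha1 ha2; field.
by rewrite hA hB ha1 ha2.
Qed.

Lemma Tmx_Smx : Tmx *m Smx = Smx *m Mmx.
Proof.
apply/matrixP => a j; rewrite !mxE.
under eq_bigr => s _ do rewrite [Smx s j]mxE.
under [RHS]eq_bigr => l _ do rewrite [Smx a l]mxE.
rewrite (Tmx_row (sgbin^~ j)) (Mmx_col (sgbin a)).
have hj : (j <= Nw)%N by rewrite -ltnS.
have -> : (if (a < Nw)%N then qq a.+1 * sgbin a.+1 j else 0)
          = qq a.+1 * sgbin a.+1 j.
  have [// | geaN] := ltnP a Nw.
  by rewrite /sgbin bin_small ?mulr0 // ltnS (leq_trans hj).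
have -> : (if (j < Nw)%N then sgbin a j.+1 * msub j.+1 else 0)
          = sgbin a j.+1 * msub j.+1.
  have [// | gejN] := ltnP j Nw.
  have -> : (j : nat) = Nw by apply/eqP; rewrite eqn_leq hj.
  rewrite /msub -nat1r (_ : Nw%:R - (1 + Nw%:R) + 1 = 0 :> R); last by ring.
  by rewrite !(mulr0, mul0r).
exact: sgbin_step.
Qed.

Lemma Smx_eigen (lambda : R) (b : 'cV[R]_(Nw.+1)) :
  Mmx *m b = lambda *: b -> Tmx *m (Smx *m b) = lambda *: (Smx *m b).
Proof. by move=> hb; rewrite mulmxA Tmx_Smx -mulmxA hb scalemxAr. Qed.

End Intertwining.

Section HypergeometricVector.
Variables (R : numFieldType) (N1 N2 Nw k : nat).
Hypotheses (hw1 : (Nw <= N1)%N) (hw2 : (Nw <= N2)%N) (hk : (k <= Nw)%N).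

Local Notation D := (N1%:R * N2%:R : R).
Local Notation b := (bk R N1 N2 Nw k).

Lemma shift_den_natr :
  (2 * k%:R - (N1 + N2)%:R : R) = (2 * k)%N%:R - (N1 + N2)%:R.
Proof. by rewrite natrM. Qed.

(* All denominators (i-k)! (2k-N)_{i-k} are nonzero: 2k + m < k + N_w <= N. *)
Lemma bden_neq0 (i : nat) : (i <= Nw)%N -> bden R N1 N2 k i != 0.
Proof.
move=> hi; rewrite /bden mulf_neq0 ?pnatr_eq0 -?lt0n ?fact_gt0 //.
by rewrite shift_den_natr poch_natr_neq0 // => m hm; lia.
Qed.

(* The entries b^k_i, k <= i <= N_w, are nonzero, since k + m < N_w <= N_1. *)
Lemma bk_neq0 (i : nat) : (k <= i)%N -> (i <= Nw)%N -> b i != 0.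
Proof.
move=> hki hi; rewrite /bk ltnNge hki /= mulf_neq0 ?invr_neq0 ?bden_neq0 //.
by rewrite !mulf_neq0 ?signr_eq0 // poch_natr_neq0 // => m hm; lia.
Qed.

Lemma bk_succ (n : nat) : (k + n.+1 <= Nw)%N ->
  b (k + n.+1) * (n.+1%:R * (2 * k%:R - (N1 + N2)%:R + n%:R))
  = - ((k%:R - N1%:R + n%:R) * (k%:R - Nw%:R + n%:R)) * b (k + n).
Proof.
move=> hi; have := bden_neq0 hi.
rewrite /bden addKn (factS n) pochS natrM !mulf_eq0 !negb_or.
case/and3P=> /andP[hn1 hfact] hpoch hlast.
rewrite /bk !ltnNge !leq_addr /= /bden !addKn (factS n) natrM !pochS exprS.
field.
by rewrite hpoch hfact -natrD hlast nat1r hn1.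
Qed.

Lemma bk_lt (i : nat) : (i < k)%N -> b i = 0.
Proof. by rewrite /bk => ->. Qed.

Lemma bprev_le (i : nat) : (i <= k)%N -> bprev R N1 N2 Nw k i = 0.
Proof. by case: i => //= i /bk_lt. Qed.

Definition bvec : 'cV[R]_(Nw.+1) := \col_(j < Nw.+1) b j.

Lemma cvec_Smx : cvec R N1 N2 Nw k = Smx R Nw *m bvec.
Proof.
apply/matrixP => a z; rewrite ord1 !mxE.
under [RHS]eq_bigr => l _ do rewrite !mxE.
rewrite -(big_mkord xpredT (fun l => sgbin R a l * b l)).
rewrite [RHS](@big_cat_nat _ _ _ a) //=; last exact: ltnW.
rewrite [X in _ = X + _]big1_seq ?add0r; last first.
  move=> j; rewrite mem_index_iota /sgbin => /andP[_ hj].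
  by rewrite bin_small ?mulr0 ?mul0r.
apply: eq_big_nat => j /andP[haj _].
by rewrite /sgbin -[in LHS]signr_odd oddB // -oddD signr_odd.
Qed.

(* The last entry of c is b^k_{N_w}, which is nonzero. *)
Lemma cvec_neq0 : cvec R N1 N2 Nw k != 0.
Proof.
apply/eqP => hc; move: (bk_neq0 hk (leqnn Nw)).
have := congr1 (fun c : 'cV[R]_(Nw.+1) => c ord_max 0) hc.
rewrite /cvec !mxE /= big_nat1 subnn expr0 binn !mul1r => ->.
by rewrite eqxx.
Qed.

Variable Nb : nat.
Hypotheses (hN1 : (1 <= N1)%N) (hN2 : (1 <= N2)%N) (hsum : (Nw + Nb = N1 + N2)%N).

Lemma bk_recurrence (i : nat) : (i <= Nw)%N ->
  D * (lam R N1 N2 k - 1) * b i =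
    (N1%:R - i%:R + 1) * (Nw%:R - i%:R + 1) * bprev R N1 N2 Nw k i
    - i%:R * (Nw%:R - i%:R + Nb%:R + 1) * b i.
Proof.
move=> hi.
have hA : (N1%:R != 0 :> R) by rewrite pnatr_eq0 -lt0n.
have hB : (N2%:R != 0 :> R) by rewrite pnatr_eq0 -lt0n.
rewrite (natr_Nb R hsum) /lam.
case: (ltngtP i k) => [ltik | ltki | ->].
- by rewrite bk_lt // bprev_le ?(ltnW ltik) // !mulr0 subr0.
- have [n def_i] : exists n, i = (k + n.+1)%N by exists (i - k).-1; lia.
  subst i.
  have hn1 : (n.+1%:R : R) != 0 by rewrite pnatr_eq0.
  have hden : (2 * k%:R - (N1 + N2)%:R + n%:R : R) != 0.
    by rewrite shift_den_natr addrAC -natrD natr_sub_neq0 //; lia.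
  rewrite addnS /= -addnS.
  rewrite -[b (k + n.+1)](mulfK (mulf_neq0 hn1 hden)) (bk_succ hi).
  field.
  by move: hden hn1; rewrite !natrD -!nat1r hA hB => -> ->.
- rewrite bprev_le // mulr0 add0r !natrD.
  by field; rewrite hA hB.
Qed.

(* The recurrence says exactly that b^k is a lambda_k-eigenvector of M. *)
Lemma Mmx_bvec : Mmx R N1 N2 Nw Nb *m bvec = lam R N1 N2 k *: bvec.
Proof.
have hA : (N1%:R != 0 :> R) by rewrite pnatr_eq0 -lt0n.
have hB : (N2%:R != 0 :> R) by rewrite pnatr_eq0 -lt0n.
apply/matrixP => j z; rewrite ord1 !mxE.
under eq_bigr => l _ do rewrite [bvec l 0]mxE.
rewrite (Mmx_row _ _ _ b).
have -> : (if (0 < j)%N then msub R N1 N2 Nw j * b j.-1 else 0)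
          = msub R N1 N2 Nw j * bprev R N1 N2 Nw k j.
  by case: (nat_of_ord j) => [|i]; rewrite ?mulr0.
have -> : lam R N1 N2 k * b j = D * (lam R N1 N2 k - 1) * b j / D + b j.
  by field; rewrite hA hB.
have hj : (j <= Nw)%N by rewrite -ltnS.
rewrite (bk_recurrence hj) /mdiag /msub.
by field; rewrite hA hB.
Qed.

Lemma cvec_eigen :
  Tmx R N1 N2 Nw Nb *m cvec R N1 N2 Nw k = lam R N1 N2 k *: cvec R N1 N2 Nw k.
Proof. by rewrite cvec_Smx; apply: Smx_eigen => //; apply: Mmx_bvec. Qed.

End HypergeometricVector.

Theorem mainTheorem3 (R : numFieldType) (N1 N2 Nw Nb : nat)
  (hN1 : (1 <= N1)%N) (hN2 : (1 <= N2)%N)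
  (hsum : (Nw + Nb = N1 + N2)%N)
  (hw1 : (Nw <= N1)%N) (hw2 : (Nw <= N2)%N)
  (k : nat) (hk : (k <= Nw)%N) :
  (forall i : nat, (k <= i <= Nw)%N -> bden R N1 N2 k i != 0)
  /\
  (forall i : nat, (i <= Nw)%N ->
     N1%:R * N2%:R * (lam R N1 N2 k - 1) * bk R N1 N2 Nw k i =
       (N1%:R - i%:R + 1) * (Nw%:R - i%:R + 1) * bprev R N1 N2 Nw k i
       - i%:R * (Nw%:R - i%:R + Nb%:R + 1) * bk R N1 N2 Nw k i)
  /\
  (cvec R N1 N2 Nw k != 0 /\
   Tmx R N1 N2 Nw Nb *m cvec R N1 N2 Nw k = lam R N1 N2 k *: cvec R N1 N2 Nw k).
Proof.
split; [|split; [|split]].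
- by move=> i /andP[_ hi]; apply: (bden_neq0 R hw1 hw2 hk hi).
- by move=> i hi; apply: (bk_recurrence R hw1 hw2 hk hN1 hN2 hsum hi).
- exact: (cvec_neq0 R hw1 hw2 hk).
- exact: (cvec_eigen R hw1 hw2 hk hN1 hN2 hsum).
Qed.
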